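(* Let $n$ be a nonnegative integer and let $\ell$ be a complex number such that $2\ell$ is not a negative integer. Then $$\sum_{k=0}^{n} \left( -\frac{1}{2} \right)^{k} \frac{ \binom{n}{k} \binom{2k+2\ell}{k} }{\binom{k+\ell}{k}} = \begin{cases} \dfrac{2^{-n} \binom{n}{n/2}}{\binom{\frac{n}{2} + \ell}{n/2}} & \text{if } n \text{ is even}, \\[2mm] 0 & \text{if } n \text{ is odd}. \end{cases}$$
   Context: For complex arguments, binomial coefficients are defined by the Gamma function: $\binom{a}{b} = \dfrac{\Gamma(a+1)}{\Gamma(b+1)\,\Gamma(a-b+1)}$. Thus $\binom{2k+2\ell}{k} = \dfrac{\Gamma(2k+2\ell+1)}{k!\,\Gamma(k+2\ell+1)}$ and $\binom{k+\ell}{k} = \dfrac{\Gamma(k+\ell+1)}{k!\,\Gamma(\ell+1)}$ for nonnegative integers $k$. *)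

(* Defs.v *)
From mathcomp Require Export all_boot all_order all_algebra complex.
From mathcomp Require Export all_classical all_reals all_analysis.

Set Implicit Arguments.
Unset Strict Implicit.
Unset Printing Implicit Defensive.

Import Order.TTheory GRing.Theory Num.Theory.
Export numFieldNormedType.Exports.

Local Open Scope classical_set_scope.
Local Open Scope ring_scope.
Local Open Scope complex_scope.

Definition cexp (R : realType) (z : R[i]) : R[i] :=
  (expR (complex.Re z))%:C * (cos (complex.Im z) +i* sin (complex.Im z)).

(* n ^ z := exp (z * ln n); [ln 0] is a junk value, but only large n matter
   below. *)
Definition npowC (R : realType) (n : nat) (z : R[i]) : R[i] :=
  cexp (z * (ln (n%:R : R))%:C).

(* Euler's limit formula
     Gamma z = lim_n  n! n^z / (z (z + 1) ... (z + n)),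
   valid for every z that is not a nonpositive integer. The regular-algebra
   tag [^o] gives R[i] the topology of its modulus. At the poles, division by
   zero makes the terms eventually 0. *)
Definition Gamma (R : realType) (z : R[i]) : R[i] :=
  lim ((fun n : nat =>
          (n`!)%:R * npowC n z / \prod_(k < n.+1) (z + k%:R) : R[i]^o) @ \oo).

Definition binC (R : realType) (a b : R[i]) : R[i] :=
  Gamma (a + 1) / (Gamma (b + 1) * Gamma (a - b + 1)).

(* Main.v *)
Require Import Defs.
From mathcomp Require Import ring lra.
Set Implicit Arguments.
Unset Strict Implicit.
Unset Printing Implicit Defensive.
Import Order.TTheory GRing.Theory Num.Theory.
Local Open Scope ring_scope.
Local Open Scope complex_scope.

(** The two Gamma quotients only matter through their dependence on [k].
Writing [b k] for the upper and [d k] for the lower binomial coefficient, the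
functional equation of Gamma gives
  [d (k+1) / d k = (l + k + 1) / (k + 1)] and
  [b (k+1) / b k = (2l + 2k + 1) (2l + 2k + 2) / ((k + 1) (2l + k + 1))],
so that [x k = (-1/2)^k b k / d k] satisfies, with [c = 2l + 1],
  [(c + k) x (k+1) = - (c + 2k) x k].
This is all that the summation uses.

Let [S n = \sum_k 'C(n, k) x k], that is, the value at 0 of [(1 + E)^n x] where
[E] is the shift. The recurrence of [x] reads
  [c (x (k+1) + x k) + k (x (k+1) + 2 x k) = 0].
Multiply by ['C(n+1, k)] and sum over [k]. Since
[k 'C(n+1, k) = (n+1) 'C(n, k-1)] and [E^2 + 2E = (1 + E)^2 - 1], this gives
  [c S (n+2) + (n + 1) (S (n+2) - S n) = 0] ([binsum_rec]).
As [S 1 = 0], the odd sums vanish, and the even ones are obtained step by step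
from [S 0 = 1]; the closed form obeys the same recurrence
([central_bin_rec]).

What remains is the analytic input on Gamma, defined by Euler's limit: away
from the poles the limit exists, is nonzero ([euler_cvg]) and satisfies
[Gamma (z + 1) = z Gamma z] ([GammaD1]); moreover [Gamma 1 = 1]. Consecutive
terms of Euler's sequence differ by the factor
[(1 - 1/m)^z (1 + z/m) = 1 + O(1/m^2)] ([euler_factor_bound]), hence the
sequence is a convergent infinite product with nonzero value
([infinite_product_cvg]). The hypothesis on [l] says exactly that no
[2l + 1 + k] vanishes; it then also keeps [l + 1 + k] away from 0, so every
Gamma value that occurs is taken outside the poles. *)

(** * Binomial sums and the two-step recurrence *)

Definition binsum (F : fieldType) (n : nat) (x : nat -> F) : F :=
  \sum_(k < n.+1) 'C(n, k)%:R * x k.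

Lemma binsumD (F : fieldType) n (x y : nat -> F) :
  binsum n (fun k => x k + y k) = binsum n x + binsum n y.
Proof. by rewrite -big_split; apply: eq_bigr => k _; rewrite mulrDr. Qed.

Lemma binsumZ (F : fieldType) n a (x : nat -> F) :
  binsum n (fun k => a * x k) = a * binsum n x.
Proof. by rewrite /binsum big_distrr; apply: eq_bigr => k _; rewrite mulrCA. Qed.

Lemma eq_binsum (F : fieldType) n (x y : nat -> F) :
  x =1 y -> binsum n x = binsum n y.
Proof. by move=> xy; apply: eq_bigr => k _; rewrite xy. Qed.

(** Pascal's rule: this is [(1 + E)^(n+1) x = (1 + E)^n (x + E x)]. *)
Lemma binsumS (F : fieldType) n (x : nat -> F) :
  binsum n.+1 x = binsum n (fun k => x k + x k.+1).
Proof.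
rewrite binsumD /binsum big_ord_recl [X in _ = X + _]big_ord_recl -addrA.
rewrite !bin0; congr (_ + _).
under eq_bigr => k _ do rewrite lift0 binS natrD mulrDl.
rewrite big_split /= big_ord_recr /= bin_small // mul0r addr0.
by congr (_ + _).
Qed.

Lemma binsum_natl (F : fieldType) n (x : nat -> F) :
  binsum n.+1 (fun k => k%:R * x k) = n.+1%:R * binsum n (fun k => x k.+1).
Proof.
rewrite /binsum big_ord_recl mul0r mulr0 add0r big_distrr /=.
apply: eq_bigr => k _; rewrite /bump leq0n add1n !mulrA; congr (_ * _).
by rewrite -!natrM mulnC mul_bin_diag.
Qed.

Section Recurrence.
Variables (F : fieldType) (c : F) (x : nat -> F).
Hypothesis xS : forall k, (c + k%:R) * x k.+1 = - (c + 2 * k%:R) * x k.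

(** The sum over [k] of the recurrence for [x], weighted by ['C(n+1, k)]: the
operator identity [E^2 + 2E = (1 + E)^2 - 1] turns the part with factor [k] into
[(n+1) (S (n+2) - S n)]. *)
Lemma binsum_rec n :
  (c + n.+1%:R) * binsum n.+2 x = n.+1%:R * binsum n x.
Proof.
have E2 : binsum n.+2 x =
    binsum n x + binsum n (fun k => x k.+2 + 2 * x k.+1).
  rewrite !binsumS -binsumD; apply: eq_binsum => k; ring.
have : binsum n.+1 (fun k => c * (x k + x k.+1)
                           + k%:R * (x k.+1 + 2 * x k)) = 0.
  rewrite /binsum big1 // => k _; apply/eqP; rewrite mulf_eq0; apply/orP; right.
  apply/eqP; transitivity ((c + k%:R) * x k.+1 + (c + 2 * k%:R) * x k).
    ring.
  by rewrite xS; ring.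
rewrite binsumD binsumZ -binsumS binsum_natl => E1.
have -> : binsum n x = binsum n.+2 x - binsum n (fun k => x k.+2 + 2 * x k.+1).
  by rewrite E2 addrK.
rewrite mulrBr mulrDl addrC; congr (_ + _).
by rewrite -[LHS]subr0 -E1; ring.
Qed.

Hypothesis c_nz : c != 0.

Lemma binsum1 : binsum 1 x = 0.
Proof.
have := xS 0; rewrite addr0 mulr0 addr0 mulNr -mulrN => /(mulfI c_nz) x1.
by rewrite /binsum !big_ord_recl big_ord0 /= x1; ring.
Qed.
End Recurrence.

(** * Estimates for exp and log *)

Section Estimates.
Import ComplexField.Normc.
Variable R : realType.
Implicit Types (a b t : R) (w z : R[i]).

(** The norm of [R[i]] is complex-valued; estimates are made with the
real-valued [normc], on which the ordered-field tactics work. *)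
Lemma normr_normc z : `|z| = (normc z)%:C.
Proof. by case: z. Qed.

Lemma normc_ge0 z : 0 <= normc z.
Proof. by case: z => a b; rewrite sqrtr_ge0. Qed.

Lemma normc_real a : normc a%:C = `|a|.
Proof. by rewrite /normc /= expr0n addr0 sqrtr_sqr. Qed.

Lemma normc_triangle w z : normc (w + z) <= normc w + normc z.
Proof. exact: le_normcD. Qed.

Lemma normc_opp z : normc (- z) = normc z.
Proof. exact: normcN. Qed.

Lemma normc_le_ReIm z : normc z <= `|complex.Re z| + `|complex.Im z|.
Proof.
case: z => a b /=; rewrite -[leRHS]ger0_norm ?addr_ge0 // -sqrtr_sqr.
rewrite ler_wsqrtr // sqrrD !real_normK ?num_real // lerD2r lerDl.
by rewrite mulrn_wge0 // mulr_ge0.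
Qed.

Lemma ge_Re_normc z : `|complex.Re z| <= normc z.
Proof.
by case: z => a b /=; rewrite -sqrtr_sqr ler_wsqrtr // lerDl sqr_ge0.
Qed.

Lemma ge_Im_normc z : `|complex.Im z| <= normc z.
Proof.
by case: z => a b /=; rewrite -sqrtr_sqr ler_wsqrtr // lerDr sqr_ge0.
Qed.

Lemma MVT0 (f df : R -> R) b : (forall x : R, is_derive x 1 f (df x)) ->
  exists2 c, `|c| <= `|b| & f b - f 0 = df c * b.
Proof.
move=> fdf.
have cf : continuous f.
  by move=> x; apply/differentiable_continuous/derivable1_diffP; case: (fdf x).
have [b0|b0] := leP 0 b.
  have [c] := MVT_segment b0 (fun x _ => fdf x) (continuous_subspaceT cf).
  rewrite in_itv /= subr0 => /andP[c0 cb] e; exists c => //.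
  by rewrite !ger0_norm.
have [c] := MVT_segment (ltW b0) (fun x _ => fdf x) (continuous_subspaceT cf).
rewrite in_itv /= => /andP[bc c0] e; exists c; last by lra.
by rewrite !ler0_norm ?lerN2 // ltW.
Qed.

Lemma normr_sin_le b : `|sin b| <= `|b|.
Proof.
have [c _] := @MVT0 sin cos b (@is_derive_sin R).
rewrite sin0 subr0 => ->; rewrite normrM ler_piMl //; exact: cos_max.
Qed.

Lemma normr_cosB1_le b : `|cos b - 1| <= b ^+ 2.
Proof.
have [c cb] := @MVT0 cos (fun x => - sin x) b (@is_derive_cos R).
rewrite cos0 => ->; rewrite normrM normrN -(real_normK (num_real b)) expr2.
rewrite ler_wpM2r //.
exact: le_trans (normr_sin_le _) cb.
Qed.

Lemma normr_sinB_le b : `|sin b - b| <= `|b| ^+ 3.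
Proof.
have d (x : R) : is_derive x 1 (fun y : R => sin y - y) (cos x - 1).
  by apply: is_deriveB.
have [c cb] := MVT0 b d.
rewrite sin0 subrr subr0 => ->; rewrite normrM [leRHS]exprSr ler_wpM2r //.
apply: le_trans (normr_cosB1_le c) _.
by rewrite -real_normK ?num_real // ler_pXn2r // nnegrE.
Qed.

(** The upper bound comes from [expR a <= 1 / (1 - a)], itself the inequality
[1 - a <= expR (- a)]. *)
Lemma expR_taylor1 a : `|a| <= 1 / 2 -> 0 <= expR a - 1 - a <= 2 * a ^+ 2.
Proof.
rewrite ler_norml => /andP[a1 a2]; apply/andP; split.
  by have := expR_ge1Dx a; lra.
have h : expR a * (1 - a) <= 1.
  rewrite -[leRHS](expRxMexpNx_1 a) ler_wpM2l ?expR_ge0 //; exact: expR_ge1Dx.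
have : expR a * (1 - a) <= (1 + a + 2 * a ^+ 2) * (1 - a) by nra.
by rewrite ler_pM2r; lra.
Qed.

Lemma cexp_taylor1 w : normc w <= 1 / 2 ->
  normc (cexp w - 1 - w) <= 4 * normc w ^+ 2.
Proof.
move=> w2; have wE : normc w ^+ 2 = complex.Re w ^+ 2 + complex.Im w ^+ 2.
  by case: (w) => p q /=; rewrite sqr_sqrtr // addr_ge0 ?sqr_ge0.
apply: le_trans (normc_le_ReIm _) _; rewrite wE.
have := le_trans (ge_Re_normc w) w2; have := le_trans (ge_Im_normc w) w2.
case: (w) => a b /=; rewrite /cexp /= !(mul0r, subr0, addr0, oppr0) => b2 a2.
have /andP[e1 e2] := expR_taylor1 a2.
have c1 := normr_cosB1_le b.
have s1 : `|sin b - b| <= b ^+ 2 / 2.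
  apply: le_trans (normr_sinB_le b) _.
  by rewrite -(@real_normK _ b) ?num_real // exprSr ler_wpM2l ?sqr_ge0 //; lra.
set E := expR a in e1 e2 *; set C := cos b in c1 *; set S := sin b in s1 *.
have E2 : E <= 2 by move: a2; rewrite ler_norml => /andP[]; nra.
have E0 : 0 <= E := expR_ge0 a.
have E1 : `|E - 1| <= 2 * `|a|.
  have -> : E - 1 = (E - 1 - a) + a by ring.
  apply: le_trans (ler_normD _ _) _; rewrite (ger0_norm e1).
  by move: e2; rewrite -(@real_normK _ a) ?num_real //; have := normr_ge0 a; nra.
have re : `|E * C - 1 - a| <= 2 * a ^+ 2 + 2 * b ^+ 2.
  have -> : E * C - 1 - a = (E - 1 - a) + E * (C - 1) by ring.
  apply: le_trans (ler_normD _ _) _; rewrite (ger0_norm e1) lerD //.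
  by rewrite normrM (ger0_norm E0) ler_pM.
have im : `|E * S - b| <= 2 * b ^+ 2 + a ^+ 2.
  have -> : E * S - b = E * (S - b) + (E - 1) * b by ring.
  apply: le_trans (ler_normD _ _) _; rewrite !normrM (ger0_norm E0).
  have h1 : E * `|S - b| <= 2 * (b ^+ 2 / 2) by rewrite ler_pM.
  have h2 : `|E - 1| * `|b| <= 2 * `|a| * `|b| by rewrite ler_wpM2r.
  have := sqr_ge0 (`|a| - `|b|).
  by rewrite sqrrB !real_normK ?num_real //; lra.
by move: re im (sqr_ge0 a); lra.
Qed.

(** Both bounds come from [ln (1 + u) <= u], taken at [u = - t] and at
[1 + u = 1 / (1 - t)]. *)
Lemma ln_taylor1 t : 0 < t <= 1 / 2 -> 0 <= - ln (1 - t) - t <= 2 * t ^+ 2.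
Proof.
move=> /andP[t0 t2]; apply/andP; split.
  by have := @le_ln1Dx R (- t); lra.
have p : 0 < 1 - t by lra.
rewrite -lnV ?posrE //.
have := @le_ln1Dx R (t / (1 - t)).
have -> : 1 + t / (1 - t) = (1 - t)^-1 by field; rewrite gt_eqF.
have q : 0 <= t / (1 - t) by rewrite divr_ge0 // ltW.
have r : t / (1 - t) <= t + 2 * t ^+ 2 by rewrite ler_pdivrMr //; nra.
lra.
Qed.

(** With [t = 1/m] this controls the factor [(1 - 1/m)^z (1 + z/m)] between
consecutive terms of Euler's sequence: the first-order terms [- z t] and [z t]
cancel, which is what makes the product of these factors converge. *)
Lemma euler_factor_bound z t : 0 < t <= 1 / 2 -> normc z * t <= 1 / 4 ->
  normc (cexp (z * (ln (1 - t))%:C) * (1 + z * t%:C) - 1)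
    <= (3 * normc z + 24 * normc z ^+ 2) * t ^+ 2.
Proof.
move=> tb zt; have /andP[l1 l2] := ln_taylor1 tb; move: tb => /andP[t0 t2].
set L := ln (1 - t) in l1 l2 *; set N := normc z in zt *.
have N0 : 0 <= N := normc_ge0 z.
have L2 : `|L| <= 2 * t by rewrite ler0_norm; nra.
set w := z * L%:C.
have wE : normc w = N * `|L| by rewrite normcM normc_real.
have wle : normc w <= 2 * (N * t) by rewrite wE; nra.
have w2 : normc w <= 1 / 2 by lra.
have r := cexp_taylor1 w2.
set r' := cexp w - 1 - w in r.
(* Each summand is of order t^2, since L + t, r' and w * t are. *)
have -> : cexp w * (1 + z * t%:C) - 1 =
   z * (L + t)%:C + (r' * (1 + z * t%:C) + w * (z * t%:C)).
  rewrite /r' /w rmorphD /=; ring.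
have nt : normc (z * t%:C) = N * t by rewrite normcM normc_real gtr0_norm.
have n1 : normc (1 + z * t%:C) <= 1 + N * t.
  by apply: le_trans (normc_triangle _ _) _; rewrite nt normc1.
apply: le_trans (normc_triangle _ _) _.
apply: le_trans (lerD (lexx _) (normc_triangle _ _)) _.
rewrite 3!normcM nt normc_real.
have A1 : N * `|L + t| <= N * (2 * t ^+ 2).
  by rewrite ler_wpM2l // ler0_norm; lra.
have A2 : normc r' * normc (1 + z * t%:C) <= 4 * (2 * (N * t)) ^+ 2 * (5 / 4).
  apply: ler_pM; rewrite ?normc_ge0 //; last by lra.
  apply: le_trans r _; rewrite ler_wpM2l //.
  by rewrite ler_pXn2r // nnegrE ?normc_ge0 // mulr_ge0 // mulr_ge0 // ltW.
have A3 : normc w * (N * t) <= 2 * (N * t) * (N * t).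
  by rewrite ler_wpM2r // mulr_ge0 // ltW.
rewrite -/N; apply: le_trans (lerD A1 (lerD A2 A3)) _.
have : 0 <= N * t ^+ 2 by rewrite mulr_ge0 // sqr_ge0.
have : 0 <= N ^+ 2 * t ^+ 2 by rewrite mulr_ge0 // sqr_ge0.
nra.
Qed.
End Estimates.

(** * Convergence of infinite products *)

Section Products.
Import ComplexField.Normc.
Local Open Scope classical_set_scope.
Variable R : realType.

(** The telescoping series of [u] converges absolutely. *)
Lemma bounded_variation_cvg (u c : nat -> R) S :
    (forall k, `|u k.+1 - u k| <= c k) ->
    (forall n, \sum_(k < n) c k <= S) ->
  exists g : R, u @ \oo --> g.
Proof.
move=> uc cS; have cv : cvgn (series (telescope u)).
  apply: normed_cvg; apply: nondecreasing_is_cvgn.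
    by apply: nondecreasing_series => *; rewrite normr_ge0.
  exists S => _ [n _ <-]; apply: le_trans (cS n).
  by rewrite /= seriesEord; apply: ler_sum => k _; exact: uc.
have := cvgD (cvg_cst (u 0%N)) cv.
have -> : (fun=> u 0%N) + series (telescope u) = u.
  by apply/funext => n; rewrite [RHS]eq_sum_telescope.
by move=> cu; eexists; exact: cu.
Qed.

(** Reduces convergence in [R[i]] to the coordinates, where the completeness of
[R] is available. *)
Lemma complex_cvg (P : nat -> R[i]) (a b : R) :
  (fun n => complex.Re (P n)) @ \oo --> a ->
  (fun n => complex.Im (P n)) @ \oo --> b ->
  (P : nat -> R[i]^o) @ \oo --> (a +i* b : R[i]^o).
Proof.
move=> /cvgrPdist_lt ca /cvgrPdist_lt cb; apply/cvgrPdist_lt => e.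
case: e => e e'; rewrite ltcE /= => /andP[/eqP -> e0].
have e2 : 0 < e / 2 by rewrite divr_gt0 //; exact: e0.
near=> n; rewrite normr_normc ltcR.
apply: le_lt_trans (normc_le_ReIm _) _; rewrite [ltRHS](splitr e) ltrD //=.
  have -> : complex.Re (a +i* b - P n) = a - complex.Re (P n) by case: (P n).
  by near: n; exact: ca.
have -> : complex.Im (a +i* b - P n) = b - complex.Im (P n) by case: (P n).
by near: n; exact: cb.
Unshelve. all: by end_near. Qed.

(** [P n] is a sequence of partial products with [P k / P (k+1) = 1 + O(c k)].
Measuring the increment against [P (k+1)] bounds [P] from below by
[P 0 / exp (sum of c)], whence the nonzero limit; since [c k <= 1/2] it also
bounds [P] from above, so that the increments are absolutely summable. *)
Lemma infinite_product_cvg (P : nat -> R[i]) (c : nat -> R) S :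
    (forall k, P k != 0) ->
    (forall k, 0 <= c k <= 1 / 2) ->
    (forall k, normc (P k - P k.+1) <= c k * normc (P k.+1)) ->
    (forall n, \sum_(k < n) c k <= S) ->
  exists2 g : R[i], g != 0 & (P : nat -> R[i]^o) @ \oo --> (g : R[i]^o).
Proof.
move=> Pn0 cb Pc cS.
have up n : normc (P n) <= normc (P 0%N) * expR (2 * \sum_(k < n) c k).
  elim: n => [|n IH]; first by rewrite big_ord0 mulr0 expR0 mulr1.
  have /andP[c0 c2] := cb n.
  rewrite big_ord_recr /= mulrDr expRD mulrA.
  apply: le_trans (_ : normc (P n) * (1 + 2 * c n) <= _); last first.
    apply: ler_pM; rewrite ?normc_ge0 ?expR_ge1Dx //; lra.
  have := normc_triangle (P n) (- (P n - P n.+1)).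
  have -> : P n + - (P n - P n.+1) = P n.+1 by ring.
  rewrite normc_opp => tri.
  have h : normc (P n.+1) * (1 - c n) <= normc (P n) by have := Pc n; lra.
  apply: le_trans (_ : normc (P n.+1) * (1 - c n) * (1 + 2 * c n) <= _).
    rewrite -mulrA ler_peMr ?normc_ge0 //; nra.
  by rewrite ler_wpM2r //; lra.
have low n : normc (P 0%N) <= normc (P n) * expR (\sum_(k < n) c k).
  elim: n => [|n IH]; first by rewrite big_ord0 expR0 mulr1.
  have /andP[c0 c2] := cb n.
  rewrite big_ord_recr /= addrC expRD mulrA.
  apply: le_trans IH _; rewrite ler_wpM2r ?expR_ge0 //.
  apply: le_trans (_ : normc (P n.+1) * (1 + c n) <= _); last first.
    by rewrite ler_wpM2l ?normc_ge0 // expR_ge1Dx.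
  have := normc_triangle (P n - P n.+1) (P n.+1).
  by rewrite subrK; move: (Pc n); lra.
set M := normc (P 0%N) * expR (2 * S).
have PM n : normc (P n) <= M.
  apply: le_trans (up n) _; rewrite ler_wpM2l ?normc_ge0 // ler_expR.
  by rewrite ler_wpM2l.
have PcM k : normc (P k.+1 - P k) <= c k * M.
  rewrite -normc_opp opprB; apply: le_trans (Pc k) _.
  by rewrite ler_wpM2l //; case/andP: (cb k).
have SM n : \sum_(k < n) c k * M <= S * M.
  by rewrite -mulr_suml ler_wpM2r // (le_trans (normc_ge0 _) (PM 0%N)).
have [|a ca] := bounded_variation_cvg (u := fun n => complex.Re (P n)) (c := fun k => c k * M) _ SM.
  move=> k; apply: le_trans (PcM k); apply: le_trans (ge_Re_normc _).
  by case: (P k) (P k.+1) => ? ? [].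
have [|b cb'] := bounded_variation_cvg (u := fun n => complex.Im (P n)) (c := fun k => c k * M) _ SM.
  move=> k; apply: le_trans (PcM k); apply: le_trans (ge_Im_normc _).
  by case: (P k) (P k.+1) => ? ? [].
have cP := complex_cvg ca cb'; exists (a +i* b) => //.
apply/eqP => g0; rewrite g0 in cP.
have P0 : 0 < normc (P 0%N).
  rewrite lt_neqAle normc_ge0 andbT eq_sym; apply/eqP => /eq0_normc.
  exact/eqP.
have /cvgrPdist_lt/(_ (normc (P 0%N) / expR S)%:C) := cP.
rewrite ltcR divr_gt0 ?expR_gt0 // => /(_ isT) [n _ /(_ n (leqnn n))] /=.
rewrite sub0r normrN normr_normc ltcR ltNge => /negP; apply.
rewrite ler_pdivrMr ?expR_gt0 //; apply: le_trans (low n) _.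
by rewrite ler_wpM2l ?normc_ge0 // ler_expR.
Qed.
End Products.

(** * The Gamma function *)

Section GammaFunction.
Import ComplexField.Normc.
Local Open Scope classical_set_scope.
Variable R : realType.
Implicit Types (z w : R[i]) (n : nat).

Definition euler z n : R[i]^o :=
  n`!%:R * npowC n z / \prod_(k < n.+1) (z + k%:R).

Lemma cexpD z w : cexp (z + w) = cexp z * cexp w.
Proof.
case: z w => [a b] [c d]; rewrite /cexp /= expRD cosD sinD.
by apply/eqP; rewrite eq_complex /=; apply/andP; split; apply/eqP; ring.
Qed.

Lemma cexp_neq0 z : cexp z != 0.
Proof.
apply/eqP => z0; have := cexpD z (- z); rewrite z0 mul0r subrr /cexp /=.
by rewrite expR0 cos0 sin0 mul1r => /eqP; rewrite eq_complex /= oner_eq0.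
Qed.

Definition nonpole z := forall m : nat, z + m%:R != 0.

Lemma natC n : n%:R = (n%:R : R)%:C :> R[i].
Proof. by rewrite rmorph_nat. Qed.

Lemma euler_neq0 z n : nonpole z -> euler z n != 0.
Proof.
move=> zn; rewrite /euler mulf_neq0 ?invr_eq0 //.
  by rewrite mulf_neq0 ?cexp_neq0 // pnatr_eq0 -lt0n fact_gt0.
by apply/prodf_neq0 => k _; exact: zn.
Qed.

Lemma eulerS z n : nonpole z -> (0 < n)%N ->
  euler z n = euler z n.+1 * (cexp (z * (ln (1 - n.+1%:R^-1))%:C)
                               * (1 + z * (n.+1%:R^-1)%:C)).
Proof.
move=> zn n0; rewrite /euler [in RHS]big_ord_recr /= factS natrM /npowC.
have m0 : (n.+1%:R : R) != 0 by rewrite pnatr_eq0.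
have -> : ln (n%:R : R) = ln (n.+1%:R) + ln (1 - n.+1%:R^-1).
  have -> : 1 - n.+1%:R^-1 = n%:R / n.+1%:R :> R.
    by move: m0; rewrite -natr1 => m0; field.
  by rewrite ln_div ?posrE ?ltr0n // addrC subrK.
rewrite rmorphD mulrDr cexpD fmorphV rmorph_nat /=.
have := zn n.+1; have : (n.+1%:R : R[i]) != 0 by rewrite pnatr_eq0.
have : \prod_(i < n.+1) (z + i%:R) != 0 by apply/prodf_neq0 => k _; exact: zn.
by move: (n.+1%:R : R[i]) => a h1 h2 h3; field; rewrite h1 h2 h3.
Qed.

(** The products are started at an index [N] beyond which
[euler_factor_bound] applies and gives factors [1 + O(1/m^2)]; the bound
[1/m^2 <= 1/(m (m - 1))] makes the sum of the errors telescope. *)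
Lemma euler_cvg z : nonpole z ->
  exists2 g : R[i], g != 0 & euler z @ \oo --> (g : R[i]^o).
Proof.
move=> zn; set C := 3 * normc z + 24 * normc z ^+ 2.
have z0 := normc_ge0 z.
have C0 : 0 <= C by rewrite addr_ge0 // mulr_ge0 // sqr_ge0.
(* The three summands give t <= 1/2, normc z * t <= 1/4 and c k <= 1/2. *)
have [N] : exists N : nat, 1 + 4 * normc z + 2 * C < N%:R.
  by exists (Num.bound (1 + 4 * normc z + 2 * C)); apply: archi_boundP; lra.
move=> NB; have N1 : (1 : R) < N%:R by lra.
have kN k : 1 < (N + k)%:R :> R.
  by apply: lt_le_trans N1 _; rewrite ler_nat leq_addr.
have kNB k : 1 + 4 * normc z + 2 * C < (N + k)%:R.
  by apply: lt_le_trans NB _; rewrite ler_nat leq_addr.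
pose c k : R := C / ((N + k)%:R * (N + k).+1%:R).
have c2 k : 0 <= c k <= 1 / 2.
  have := kN k; have := kNB k; rewrite /c -(natr1 (N + k)); set m : R := (N + k)%:R => h1 h2.
  have p : 0 < m * (m + 1) by nra.
  apply/andP; split; first by rewrite divr_ge0 // ltW.
  by rewrite ler_pdivrMr //; nra.
have cS n : \sum_(k < n) c k <= C / N%:R.
  suff -> : \sum_(k < n) c k = C / N%:R - C / (N + n)%:R.
    by rewrite gerBl divr_ge0.
  elim: n => [|n IH]; first by rewrite big_ord0 addn0 subrr.
  rewrite big_ord_recr /= IH /c addnS -natr1.
  have := kN n; set m : R := (N + n)%:R => h1.
  field; apply/and3P; split; apply/eqP; lra.
have Pc k : normc (euler z (N + k) - euler z (N + k).+1)
    <= c k * normc (euler z (N + k).+1).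
  have n0 : (0 < N + k)%N by rewrite -(ltr_nat R) (lt_trans _ (kN k)).
  rewrite (eulerS zn n0) -[X in _ - X]mulr1 -mulrBr normcM mulrC.
  rewrite ler_wpM2r ?normc_ge0 //.
  have := kN k; have := kNB k; rewrite /c -(natr1 (N + k)); set m : R := (N + k)%:R => h1 h2.
  have p : 0 < m + 1 by lra.
  apply: le_trans (euler_factor_bound _ _) _.
  - by rewrite invr_gt0 p /= invf_ple ?posrE //; lra.
  - by rewrite ler_pdivrMr //; lra.
  rewrite -/C ler_wpM2l // expr2 invfM ler_wpM2r ?invr_ge0 ?(ltW p) //.
  by rewrite lef_pV2 ?posrE //; lra.
have P0 k : euler z (N + k) != 0 by exact: euler_neq0.
have PcS k : normc (euler z (N + k) - euler z (N + k.+1))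
    <= c k * normc (euler z (N + k.+1)) by rewrite addnS; exact: Pc.
have [g g0 cg] := infinite_product_cvg P0 c2 PcS cS.
exists g => //; rewrite -(cvg_shiftn N).
by under eq_fun => k do rewrite addnC.
Qed.

Lemma Gamma_lim z (g : R[i]) : euler z @ \oo --> (g : R[i]^o) -> Gamma z = g.
Proof.
move=> cg; have hC := @norm_hausdorff _ (R[i]^o : normedModType R[i]).
exact: (@cvg_lim (R[i]^o) hC _ _ _ _ g cg).
Qed.

Lemma Gamma_cvg z : nonpole z -> euler z @ \oo --> (Gamma z : R[i]^o).
Proof. by move=> /euler_cvg[g _ cg]; rewrite (Gamma_lim cg); exact: cg. Qed.

Lemma Gamma_neq0 z : nonpole z -> Gamma z != 0.
Proof. by move=> /euler_cvg[g g0 cg]; rewrite (Gamma_lim cg). Qed.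

(** At [z + 1] this is the discrepancy between Euler's sequences for [z + 1] and
for [z], see [eulerD1]; at [z = 1] it is Euler's sequence itself. *)
Lemma cvg_ratio z :
  (fun n => n.+1%:R / (z + n.+1%:R) : R[i]^o) @ \oo --> (1 : R[i]^o).
Proof.
have inv0 : (fun n => n.+1%:R^-1 : R[i]^o) @ \oo --> (0 : R[i]^o).
  have -> : (0 : R[i]) = 0 +i* 0 by [].
  apply: complex_cvg; last first.
    have -> : (fun n => complex.Im (n.+1%:R^-1 : R[i])) = (fun=> 0).
    by apply/funext => n; rewrite natC -fmorphV.
  exact: cvg_cst.
  have -> : (fun n => complex.Re (n.+1%:R^-1 : R[i])) = @harmonic R.
    by apply/funext => n; rewrite natC -fmorphV.
  exact: cvg_harmonic.
have c1 : (fun n => (1 + z * n.+1%:R^-1)^-1 : R[i]^o) @ \oo --> (1 : R[i]^o).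
  rewrite -[X in _ --> X]invr1; apply: cvgV; first exact: oner_neq0.
  rewrite -[X in _ --> X]addr0; apply: cvgD; first exact: cvg_cst.
  by rewrite -(mulr0 z); apply: cvgM; [exact: cvg_cst | exact: inv0].
apply: cvg_trans c1; apply: near_eq_cvg; near=> n.
have n0 : (n.+1%:R : R[i]) != 0 by rewrite pnatr_eq0.
rewrite -[X in X + _](divff n0) -mulrDl invfM invrK mulrC.
by rewrite (addrC z).
Unshelve. all: by end_near. Qed.

Lemma cexp_ln_nat n : cexp (ln (n.+1%:R : R))%:C = n.+1%:R.
Proof.
rewrite /cexp /= cos0 sin0 lnK ?posrE ?ltr0n // (natC n.+1).
exact: mulr1.
Qed.

Lemma eulerD1 z n : nonpole z ->
  euler (z + 1) n.+1 = z * euler z n.+1 * (n.+1%:R / (z + 1 + n.+1%:R)).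
Proof.
move=> zn; rewrite /euler big_ord_recr [in RHS]big_ord_recl /= addr0.
rewrite /npowC mulrDl mul1r cexpD.
rewrite cexp_ln_nat.
have -> : \prod_(i < n.+1) (z + 1 + i%:R) =
          \prod_(i < n.+1) (z + (bump 0 i)%:R).
  by apply: eq_bigr => i _; rewrite /bump leq0n natrD addrA.
have z0 : z != 0 by have := zn 0; rewrite addr0.
have := zn n.+2; rewrite -addn1 addnC natrD addrA => z2.
have : \prod_(i < n.+1) (z + (bump 0 i)%:R) != 0.
  by apply/prodf_neq0 => k _; exact: zn.
by move: z2; move: (n.+1%:R : R[i]) => a z2 h; field; rewrite z0 h z2.
Qed.

Lemma nonpoleD1 z : nonpole z -> nonpole (z + 1).
Proof. by move=> zn m; rewrite -addrA nat1r; exact: zn. Qed.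

Lemma GammaD1 z : nonpole z -> Gamma (z + 1) = z * Gamma z.
Proof.
move=> zn; apply: Gamma_lim; rewrite -cvg_shiftS.
under eq_fun => n do rewrite eulerD1 //.
have -> : z * Gamma z = z * Gamma z * 1 by rewrite mulr1.
apply: cvgM; last exact: cvg_ratio.
apply: cvgM; first exact: cvg_cst.
by have := Gamma_cvg zn; rewrite -cvg_shiftS; exact.
Qed.

Lemma nonpole1 : nonpole 1.
Proof. by move=> m; rewrite nat1r pnatr_eq0. Qed.

Lemma Gamma1 : Gamma (1 : R[i]) = 1.
Proof.
apply: Gamma_lim; rewrite -cvg_shiftS.
have -> : (fun n => euler 1 n.+1) = (fun n => n.+1%:R / (1 + n.+1%:R)).
  apply/funext => n; rewrite /euler /npowC mul1r.
  rewrite cexp_ln_nat.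
  have fE m : \prod_(k < m) (1 + k%:R) = m`!%:R :> R[i].
    elim: m => [|m IH]; first by rewrite big_ord0.
    by rewrite big_ord_recr /= IH nat1r factS mulnC natrM.
  rewrite big_ord_recr /= fE invfM mulrACA divff ?mul1r //.
exact: cvg_ratio.
Qed.
End GammaFunction.

(** * Gamma binomial coefficients along the sum *)

Lemma central_bin_rec m :
  (m.+1 * 'C(m.+1.*2, m.+1) = 2 * (m.*2.+1 * 'C(m.*2, m)))%N.
Proof.
have e1 := mul_bin_diag m.+1.*2 m; rewrite doubleS /= in e1.
have e2 := mul_bin_down m.*2.+1 m; rewrite /= in e2.
rewrite e2 doubleS -e1 -doubleS -mul2n -addnn -addSn addnK.
by rewrite -mulnA.
Qed.

Section BinomialCoefficients.
Variables (R : realType) (l : R[i]).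

Lemma nonpoleDn (z : R[i]) m : nonpole z -> nonpole (z + m%:R).
Proof. by move=> zn j; rewrite -addrA -natrD. Qed.

Lemma nonpole_natS k : nonpole (k.+1%:R : R[i]).
Proof. by move=> j; rewrite -natrD addSn pnatr_eq0. Qed.

Lemma binC_nat_shift k : nonpole (l + 1) ->
  k.+1%:R * binC (k.+1%:R + l) k.+1%:R = (l + k.+1%:R) * binC (k%:R + l) k%:R.
Proof.
move=> ln; have kn := nonpoleDn k ln; have kp := nonpole_natS k.
rewrite /binC ![_ + l]addrC.
have -> : l + k.+1%:R - k.+1%:R = l by rewrite addrK.
have -> : l + k%:R - k%:R = l by rewrite addrK.
have -> : l + k.+1%:R = l + 1 + k%:R by rewrite -addrA nat1r.
have -> : l + k%:R + 1 = l + 1 + k%:R by rewrite addrAC.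
rewrite (GammaD1 kn) (GammaD1 kp) natr1.
have k0 : (k.+1%:R : R[i]) != 0 by rewrite pnatr_eq0.
have := Gamma_neq0 kp; have := Gamma_neq0 ln.
move: (k.+1%:R : R[i]) k0 => a a0.
move: (Gamma (_ + k%:R)) (Gamma (l + 1)) (Gamma a) => G3 G1 G2 g1 g2.
by field; rewrite a0 g1 g2.
Qed.

Lemma binC_n0 (a : R[i]) : nonpole (a + 1) -> binC a 0 = 1.
Proof.
move=> an; rewrite /binC add0r Gamma1 subr0 mul1r divff //; exact: Gamma_neq0.
Qed.

Lemma binC_nat_neq0 k : nonpole (l + 1) -> binC (k%:R + l) k%:R != 0.
Proof.
move=> ln; elim: k => [|k IH]; first by rewrite add0r binC_n0 // oner_neq0.
have : (l + k.+1%:R) * binC (k%:R + l) k%:R != 0.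
  by rewrite mulf_neq0 // -nat1r addrA; exact: ln.
by rewrite -binC_nat_shift // mulf_eq0 => /norP[].
Qed.

(** Both Gamma values with a moving argument advance: the upper argument by 2,
the lower by 1. *)
Lemma binC_double_shift k : nonpole (2 * l + 1) ->
  k.+1%:R * (2 * l + 1 + k%:R) * binC (2 * k.+1%:R + 2 * l) k.+1%:R =
  (2 * l + 2 * k%:R + 1) * (2 * l + 2 * k%:R + 2) *
    binC (2 * k%:R + 2 * l) k%:R.
Proof.
move=> ln; have kn m := nonpoleDn m ln; have kp := nonpole_natS k.
rewrite /binC.
have -> : 2 * k.+1%:R + 2 * l + 1 = 2 * l + 1 + (2 * k)%:R + 1 + 1.
  by rewrite -natr1 natrM; ring.
have -> : 2 * k%:R + 2 * l + 1 = 2 * l + 1 + (2 * k)%:R.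
  by rewrite natrM; ring.
have -> : 2 * k.+1%:R + 2 * l - k.+1%:R + 1 = 2 * l + 1 + k%:R + 1.
  by rewrite -natr1; ring.
have -> : 2 * k%:R + 2 * l - k%:R + 1 = 2 * l + 1 + k%:R by ring.
rewrite (GammaD1 (nonpoleD1 (kn _))) (GammaD1 (kn _)) (GammaD1 kp) natr1.
rewrite (GammaD1 (kn k)).
have k0 : (k.+1%:R : R[i]) != 0 by rewrite pnatr_eq0.
have l0 := ln k.
have := Gamma_neq0 kp; have := Gamma_neq0 (kn k).
move: (k.+1%:R : R[i]) k0 => a a0.
move: (Gamma (_ + (2 * k)%:R)) (Gamma (_ + k%:R)) (Gamma a) => G1 G2 G3 g2 g3.
rewrite natrM; move: (k%:R : R[i]) l0 => b l0.
by field; rewrite a0 g2 g3 l0.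
Qed.
End BinomialCoefficients.

(** * The summation formula *)

Theorem proposition2 (R : realType) (n : nat) (l : R[i])
    (hl : forall m : nat, (0 < m)%N -> 2%:R * l <> - m%:R) :
  \sum_(k < n.+1)
     (- (1 / 2%:R)) ^+ k
       * (('C(n, k))%:R * binC (2%:R * k%:R + 2%:R * l) k%:R
            / binC (k%:R + l) k%:R)
  = if odd n then 0
    else 2%:R ^- n * ('C(n, n./2))%:R / binC ((n./2)%:R + l) (n./2)%:R.
Proof.
have ln2 : nonpole (2 * l + 1).
  move=> m; rewrite -addrA nat1r; apply/eqP => e; apply: (hl m.+1) => //.
  by move/eqP: e; rewrite addr_eq0 => /eqP.
have ln : nonpole (l + 1).
  move=> m; apply/eqP => e; have := ln2 (m.*2.+1); rewrite -(natr1 m.*2) -mul2n natrM.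
  have -> : 2 * l + 1 + (2 * m%:R + 1) = 2 * (l + 1 + m%:R) :> R[i] by ring.
  by rewrite e mulr0 eqxx.
pose d k := binC (k%:R + l) k%:R; pose b k := binC (2 * k%:R + 2 * l) k%:R.
pose x k := (- (1 / 2)) ^+ k * (b k / d k).
have d0 k : d k != 0 by exact: binC_nat_neq0.
have dS k : d k.+1 = (l + 1 + k%:R) * d k / k.+1%:R.
  have k0 : (k.+1%:R : R[i]) != 0 by rewrite pnatr_eq0.
  by rewrite -addrA nat1r /d -binC_nat_shift // mulrAC divff // mul1r.
have bS k : b k.+1 = (2 * l + 2 * k%:R + 1) * (2 * l + 2 * k%:R + 2) * b k
        / (k.+1%:R * (2 * l + 1 + k%:R)).
  have k0 : k.+1%:R * (2 * l + 1 + k%:R) != 0.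
    by rewrite mulf_neq0 ?pnatr_eq0 //; exact: ln2.
  by rewrite /b -binC_double_shift // mulrAC divff // mul1r.
have xS k : (2 * l + 1 + k%:R) * x k.+1 = - (2 * l + 1 + 2 * k%:R) * x k.
  have k0 : (k.+1%:R : R[i]) != 0 by rewrite pnatr_eq0.
  have lk := ln k; have lk2 := ln2 k; have dk := d0 k.
  rewrite /x dS bS exprS.
  move: (k.+1%:R : R[i]) k0 => a a0.
  move: (k%:R : R[i]) lk lk2 => c lk lk2.
  by field; rewrite a0 dk lk lk2.
have -> : \sum_(k < n.+1) (- (1 / 2)) ^+ k *
    ('C(n, k)%:R * binC (2 * k%:R + 2 * l) k%:R / binC (k%:R + l) k%:R)
    = binsum n x.
  by apply: eq_bigr => k _; rewrite /x -/(b k) -/(d k); ring.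
have c0 : 2 * l + 1 != 0 by have := ln2 0; rewrite addr0.
have cn m : 2 * l + 1 + m.+1%:R != 0 by exact: ln2.
have rec m : binsum m.+2 x = m.+1%:R / (2 * l + 1 + m.+1%:R) * binsum m x.
  apply: (mulfI (cn m)); rewrite (binsum_rec xS).
  by rewrite mulrA mulrCA divff // mulr1.
have odd0 m : binsum m.*2.+1 x = 0.
  elim: m => [|m IH]; first exact: (binsum1 xS c0).
  by rewrite doubleS rec IH mulr0.
have even m : binsum m.*2 x = 2 ^- m.*2 * 'C(m.*2, m)%:R / d m.
  elim: m => [|m IH].
    rewrite /binsum big_ord_recl big_ord0 bin0 expr0 invr1 !mul1r addr0 /x /=.
    by rewrite expr0 mul1r /b /d !mulr0 !add0r !binC_n0 // mul1r.
  rewrite doubleS rec IH dS.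
  have k0 : (m.+1%:R : R[i]) != 0 by rewrite pnatr_eq0.
  have := congr1 (fun k => k%:R : R[i]) (central_bin_rec m).
  rewrite /= !natrM doubleS => cS.
  have -> : 'C(m.*2.+2, m.+1)%:R =
      2 * (m.*2.+1%:R * 'C(m.*2, m)%:R) / m.+1%:R :> R[i].
    by rewrite -cS mulrAC divff // mul1r.
  have -> : 2 * l + 1 + m.*2.+1%:R = 2 * (l + 1 + m%:R).
    by rewrite -(natr1 m.*2) -mul2n natrM; ring.
  rewrite !exprS; have lm := ln m; have dm := d0 m.
  have : (2 ^+ m.*2 : R[i]) != 0 by rewrite expf_neq0 // pnatr_eq0.
  move: ('C(_, _)%:R : R[i]) (2 ^+ m.*2 : R[i]) (m.*2.+1%:R : R[i]) => p q r q0.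
  move: (m.+1%:R : R[i]) k0 => a a0; move: (m%:R : R[i]) lm => c lm.
  by field; rewrite a0 q0 dm lm.
rewrite -[n]odd_double_half; case: (odd n) => /=; last first.
  by rewrite add0n doubleK odd_double even.
by rewrite add1n /= odd_double /= odd0.
Qed.
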